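(* Let $V$ be a $7$-dimensional real vector space and let $\phi,\phi'\in\Lambda^3V^*$. Then the following holds: (i) $\phi$ is nondegenerate if and only if it admits a compatible inner product. (ii) The inner product in (i), if it exists, is uniquely determined by $\phi$. (iii) If $\phi$ and $\phi'$ are nondegenerate, the vectors $u,v,w\in V$ are orthonormal for $\phi$ (i.e. with respect to the inner product compatible with $\phi$) and satisfy $\phi(u,v,w)=0$, and the vectors $u',v',w'\in V$ are orthonormal for $\phi'$ and satisfy $\phi'(u',v',w')=0$, then there exists a $g\in\mathrm{Aut}(V)$ such that $g(u)=u'$, $g(v)=v'$, $g(w)=w'$, and $g^*\phi'=\phi$.
   Context: A $3$-form $\phi\in\Lambda^3V^*$ on a real vector space $V$ is called nondegenerate if, for every pair of linearly independent vectors $u,v\in V$, there is a vector $w\in V$ such that $\phi(u,v,w)\neq0$. A cross product on a finite dimensional real Hilbert space $V$ is a skew-symmetric bilinear map $V\times V\to V$, $(u,v)\mapsto u\times v$, satisfying $\langle u\times v,u\rangle=\langle u\times v,v\rangle=0$ and $|u\times v|^2=|u|^2|v|^2-\langle u,v\rangle^2$ for all $u,v\in V$. An inner product on $V$ is called compatible with $\phi\in\Lambda^3V^*$ if the bilinear map $V\times V\to V$ defined by $\langle u\times v,w\rangle:=\phi(u,v,w)$ is a cross product. $\mathrm{Aut}(V)$ is the group of linear automorphisms of $V$. *)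

(* Defs.v *)
From mathcomp Require Import all_boot all_order all_algebra.
From mathcomp Require Import reals.

Set Implicit Arguments.
Unset Strict Implicit.
Unset Printing Implicit Defensive.

Import GRing.Theory Num.Theory.
Local Open Scope ring_scope.

(* Inner products on a real vector space V are the library's positive definite
   symmetric bilinear forms {dot V for idfun}; in particular |u|^2 is g u u. *)

(* Lambda^3 V^*, as the alternating trilinear maps on V. *)
Record form3 (R : realType) (V : vectType R) := Form3 {
  form3_fun :> V -> V -> V -> R;
  form3_linear1 : forall v w, scalar (fun u => form3_fun u v w);
  form3_linear2 : forall u w, scalar (fun v => form3_fun u v w);
  form3_linear3 : forall u v, scalar (fun w => form3_fun u v w);
  form3_alt12 : forall u w, form3_fun u u w = 0;
  form3_alt23 : forall u w, form3_fun u w w = 0;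
  form3_alt13 : forall u w, form3_fun u w u = 0
}.

Definition form3_nondegenerate (R : realType) (V : vectType R)
    (phi : form3 V) : Prop :=
  forall u v : V, free [:: u; v] -> exists w : V, phi u v w != 0.

Record cross_product (R : realType) (V : vectType R) (g : {dot V for idfun})
    (cr : V -> V -> V) : Prop := CrossProduct {
  cross_linearl : forall v, linear (fun u => cr u v);
  cross_linearr : forall u, linear (cr u);
  cross_skew : forall u v, cr u v = - cr v u;
  cross_orthol : forall u v, g (cr u v) u = 0;
  cross_orthor : forall u v, g (cr u v) v = 0;
  cross_norm : forall u v, g (cr u v) (cr u v) = g u u * g v v - g u v ^+ 2
}.

(* As g is definite and V is finite dimensional, exactly one map cr satisfies
   the first clause, so "exists" only names it. *)
Definition compatible (R : realType) (V : vectType R) (g : {dot V for idfun})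
    (phi : form3 V) : Prop :=
  exists cr : V -> V -> V,
    (forall u v w, g (cr u v) w = phi u v w) /\ cross_product g cr.

(* Main.v *)
Require Import Defs.
From HB Require Import structures.
From mathcomp Require Import all_boot all_order all_algebra.
From mathcomp Require Import reals ring lra.

Set Implicit Arguments.
Unset Strict Implicit.
Unset Printing Implicit Defensive.

Import Order.TTheory GRing.Theory Num.Theory.
Local Open Scope ring_scope.

(** The proof rests on Cayley frames: seven vectors e0, ..., e6 on which phi
    takes the values of the triple product of the imaginary octonions in the
    basis u, v, u v, w, u w, v w, (u v) w (record cayley_frame).  Such vectors
    form a basis, and in a Cayley frame the theorem becomes computation.

    A Cayley frame gives a compatible inner product, the one for which it is
    orthonormal, because of the norm identity of the octonions
    (cayley_cross_norm, cayley_compatible).  Two Cayley frames, for phi and for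
    phi', are exchanged by an automorphism that pulls phi' back to phi
    (cayley_iso).  Conversely, if g is compatible with phi, then orthonormal u,
    v, w with phi(u, v, w) = 0 generate a Cayley frame: the identity
    u x (u x v) = <u, v> u - |u|^2 v and its polarization determine all the
    products (cayley_of_orthonormal).  This proves (iii).

    For (ii), let e be a Cayley frame of phi and let x be the cross product of
    any compatible g.  As g(a x b, -) = phi(a, b, -), the frame relations force
    e3 x e6 = e0 x e1 and e0 x e6 = e1 x e3.  Hence
    e0 x (e3 x e6) + e3 x (e0 x e6) lies in the span of e0, e1, e3, whereas the
    polarized identity gives it the component - 2 g(e0, e3) along e6.  So
    g(e0, e3) = 0 (cayley_orthogonal).  Since any g1-orthonormal pair occurs as
    (e0, e3) in some Cayley frame, two compatible inner products have the same
    orthogonal pairs; they are therefore proportional, and comparing the norms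
    of the two cross products shows that the factor l satisfies l^3 = 1.

    The hard half of (i) is that a nondegenerate phi has a Cayley frame
    (exists_cayley_frame).  Take u, x, f with k = phi(u, x, f) <> 0 and a
    complement Y of the plane of u and x in the kernel of phi(u, x, -).  The
    two-forms that the vectors of the plane of u and x induce on the
    four-dimensional space Y have no real degenerate combination, since phi is
    nondegenerate (frame_pencil).  So their Pfaffian is definite, and a basis
    of Y brings the forms of u and x to a standard pair (exists_frame2).
    Shearing Y along u and x, and f along Y, removes all the other mixed terms
    (exists_frame3); a further change of f makes its two-form wedge to zero
    with those of u and x, and the same definiteness applies to it.  The three
    two-forms are then a hyperkaehler triple, which has a standard basis
    depending on one scale c only.  The sign of c / k distinguishes the compact
    from the split form of G2, and the split one has degenerate vectors
    (frame3_sign).  For the right sign, rescaling by a square root and a cube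
    root yields a Cayley frame. *)

(** * Calculus of 3-forms *)

Section Form3Calculus.
Variables (R : realType) (V : vectType R) (phi : form3 V).
Implicit Types (a : R) (u v w x y z : V).

Lemma form3D1 x y v w : phi (x + y) v w = phi x v w + phi y v w.
Proof. by have := form3_linear1 phi v w 1 x y; rewrite scale1r mul1r. Qed.

Lemma form3D2 u x y w : phi u (x + y) w = phi u x w + phi u y w.
Proof. by have := form3_linear2 phi u w 1 x y; rewrite scale1r mul1r. Qed.

Lemma form3D3 u v x y : phi u v (x + y) = phi u v x + phi u v y.
Proof. by have := form3_linear3 phi u v 1 x y; rewrite scale1r mul1r. Qed.

Lemma form3_swap12 u v w : phi v u w = - phi u v w.
Proof.
have := form3_alt12 phi (u + v) w.
by rewrite form3D1 !form3D2 !form3_alt12 add0r addr0 =>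
  /eqP; rewrite addrC addr_eq0 => /eqP.
Qed.

Lemma form3_swap23 u v w : phi u w v = - phi u v w.
Proof.
have := form3_alt23 phi u (v + w).
by rewrite form3D2 !form3D3 !form3_alt23 add0r addr0 =>
  /eqP; rewrite addrC addr_eq0 => /eqP.
Qed.

Lemma form3_0 v w : phi 0 v w = 0.
Proof. by apply: (@addrI _ (phi 0 v w)); rewrite -form3D1 !addr0. Qed.

Lemma form3Z1 a u v w : phi (a *: u) v w = a * phi u v w.
Proof. by have := form3_linear1 phi v w a u 0; rewrite addr0 form3_0 addr0. Qed.

Lemma form3Z2 a u v w : phi u (a *: v) w = a * phi u v w.
Proof. by rewrite form3_swap12 form3Z1 form3_swap12 mulrN opprK. Qed.

Lemma form3Z3 a u v w : phi u v (a *: w) = a * phi u v w.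
Proof. by rewrite form3_swap23 form3Z2 form3_swap23 mulrN opprK. Qed.

Lemma form3N1 u v w : phi (- u) v w = - phi u v w.
Proof. by rewrite -scaleN1r form3Z1 mulN1r. Qed.

Lemma form3N2 u v w : phi u (- v) w = - phi u v w.
Proof. by rewrite -scaleN1r form3Z2 mulN1r. Qed.

Lemma form3N3 u v w : phi u v (- w) = - phi u v w.
Proof. by rewrite -scaleN1r form3Z3 mulN1r. Qed.

Definition form3E := (form3D1, form3D2, form3D3, form3Z1, form3Z2, form3Z3,
  form3N1, form3N2, form3N3, form3_alt12 phi, form3_alt23 phi, form3_alt13 phi).

Lemma form3_orient u v w t : phi u v w = t ->
  (phi u v w = t) * (phi v u w = - t) * (phi u w v = - t) *
  (phi v w u = t) * (phi w u v = t) * (phi w v u = - t).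
Proof.
move=> <-; have cyc x y z : phi y z x = phi x y z.
  by rewrite form3_swap23 form3_swap12 opprK.
by rewrite (form3_swap12 u v) (form3_swap23 u v) (form3_swap12 v w) (cyc u v) -(cyc w u).
Qed.

End Form3Calculus.

(** Evaluates phi on explicit linear combinations.  A hypothesis phi a b c = t
    serves for all six orders of a, b, c, so that a table over increasing triples
    is enough. *)
Ltac form3_table :=
  rewrite ?form3E;
  repeat match goal with
  | H : form3_fun _ _ _ _ = _ |- _ => progress rewrite ?(form3_orient H)
  end.

Section SevenVectors.
Variables (R : realType) (V : vectType R).
Hypothesis dimV : \dim {:V} = 7%N.

Lemma free7 (e0 e1 e2 e3 e4 e5 e6 : V) :
  (forall c0 c1 c2 c3 c4 c5 c6 : R,
     c0 *: e0 + c1 *: e1 + c2 *: e2 + c3 *: e3 + c4 *: e4 + c5 *: e5 + c6 *: e6 = 0 ->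
     [/\ c0 = 0, c1 = 0, c2 = 0 & [/\ c3 = 0, c4 = 0, c5 = 0 & c6 = 0]]) ->
  free [:: e0; e1; e2; e3; e4; e5; e6].
Proof.
move=> H; apply/(@freeP _ _ 7 [tuple e0; e1; e2; e3; e4; e5; e6]) => k.
rewrite !big_ord_recl big_ord0 /= addr0 !addrA => /H[k0 k1 k2 [k3 k4 k5 k6]] i.
case: i => [[|[|[|[|[|[|[|//]]]]]]] lti];
  by [rewrite -[RHS]k0; congr k; apply: val_inj
     |rewrite -[RHS]k1; congr k; apply: val_inj
     |rewrite -[RHS]k2; congr k; apply: val_inj
     |rewrite -[RHS]k3; congr k; apply: val_inj
     |rewrite -[RHS]k4; congr k; apply: val_inj
     |rewrite -[RHS]k5; congr k; apply: val_inj
     |rewrite -[RHS]k6; congr k; apply: val_inj].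
Qed.

Lemma free7_basis (X : seq V) : free X -> size X = 7%N -> basis_of {:V} X.
Proof. by move=> freeX sX; rewrite basisEfree freeX subvf sX dimV. Qed.

Lemma scalar_0 (l : V -> R) : scalar l -> l 0 = 0.
Proof.
by move=> /(_ 1 0 0); rewrite scale1r mul1r addr0 -[X in X = _]addr0 => /addrI.
Qed.

Lemma scalar_Z (l : V -> R) a v : scalar l -> l (a *: v) = a * l v.
Proof.
by move=> sl; have := sl a v 0; rewrite scalar_0 // !addr0.
Qed.

Lemma scalar_eq0_span (X : seq V) (l : V -> R) :
  scalar l -> (forall e, e \in X -> l e = 0) -> forall z, z \in <<X>>%VS -> l z = 0.
Proof.
move=> sl l0 z /(@coord_span _ _ _ (in_tuple X)) ->.
elim/big_rec: _ => [|i y _ ly]; first exact: scalar_0.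
by rewrite sl ly addr0 l0 ?mulr0 //; apply: mem_nth.
Qed.

(** The functional l rules out that w is a multiple of v, and m that v = 0. *)
Lemma free_pair (v w : V) (l m : V -> R) : scalar l -> scalar m ->
  l v = 0 -> l w != 0 -> m v != 0 -> free [:: v; w].
Proof.
move=> sl sm lv lw mv; rewrite free_cons seq1_free span_seq1; apply/andP; split.
  apply/vlineP => -[a v_aw]; move: mv lv; rewrite v_aw !scalar_Z // => mv /eqP.
  by rewrite mulf_eq0 (negPf lw) orbF => /eqP a0; rewrite a0 mul0r eqxx in mv.
by apply: contraNneq lw => ->; rewrite scalar_0.
Qed.

End SevenVectors.

(** * Frames adapted to a two-form *)

Section Frames.
Variables (R : realType) (V : vectType R) (phi : form3 V).
Hypothesis dimV : \dim {:V} = 7%N.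
Hypothesis nd_phi : form3_nondegenerate phi.

(** The span Y of y1, ..., y4 is a complement of the plane of u and x in the
    kernel of phi(u, x, -), with a symplectic basis for the two-form of u. *)
Record frame (k : R) (u x f y1 y2 y3 y4 : V) : Prop := Frame {
  frame_neq0 : k != 0; frame_uxf : phi u x f = k;
  frame_ux1 : phi u x y1 = 0; frame_ux2 : phi u x y2 = 0;
  frame_ux3 : phi u x y3 = 0; frame_ux4 : phi u x y4 = 0;
  frame_u12 : phi u y1 y2 = 1; frame_u13 : phi u y1 y3 = 0;
  frame_u14 : phi u y1 y4 = 0; frame_u23 : phi u y2 y3 = 0;
  frame_u24 : phi u y2 y4 = 0; frame_u34 : phi u y3 y4 = 1
}.

(** The frame relations alone force linear independence, which is why changes
    of frame below only need values of phi. *)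
Lemma frame_free k u x f y1 y2 y3 y4 : frame k u x f y1 y2 y3 y4 ->
  free [:: u; x; f; y1; y2; y3; y4].
Proof.
case=> k0 uxf x1 x2 x3 x4 u12 u13 u14 u23 u24 u34.
apply: free7 => c0 c1 c2 c3 c4 c5 c6; set s := (X in X = 0) => s0.
have ev v w : phi v w s = 0 by rewrite s0 (form3_orient (form3_0 phi v w)).
(* The contractions with the frame read off the coefficients of s. *)
have c2_0 : c2 = 0.
  apply/eqP; rewrite -(mulIr_eq0 _ (mulIf k0)) -(ev u x) /s; apply/eqP.
  by form3_table; ring.
have c3_0 : c3 = 0.
  by rewrite -(ev y2 u) /s c2_0; form3_table; ring.
have c4_0 : c4 = 0.
  by rewrite -(ev u y1) /s c2_0; form3_table; ring.
have c5_0 : c5 = 0.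
  by rewrite -(ev y4 u) /s c2_0; form3_table; ring.
have c6_0 : c6 = 0.
  by rewrite -(ev u y3) /s c2_0; form3_table; ring.
have c1_0 : c1 = 0.
  apply/eqP; rewrite -(mulIr_eq0 _ (mulIf k0)) -(ev f u) /s; apply/eqP.
  by rewrite c2_0 c3_0 c4_0 c5_0 c6_0; form3_table; ring.
have c0_0 : c0 = 0.
  apply/eqP; rewrite -(mulIr_eq0 _ (mulIf k0)) -(ev x f) /s; apply/eqP.
  by rewrite c1_0 c2_0 c3_0 c4_0 c5_0 c6_0; form3_table; ring.
by [].
Qed.

Lemma frame_zero k u x f y1 y2 y3 y4 v w : frame k u x f y1 y2 y3 y4 ->
  phi v w u = 0 -> phi v w x = 0 -> phi v w f = 0 ->
  phi v w y1 = 0 -> phi v w y2 = 0 -> phi v w y3 = 0 -> phi v w y4 = 0 ->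
  ~ free [:: v; w].
Proof.
move=> F vwu vwx vwf vw1 vw2 vw3 vw4 /nd_phi[z /eqP[]].
have /span_basis spanF := free7_basis dimV (frame_free F) (erefl _).
have: z \in <<[:: u; x; f; y1; y2; y3; y4]>>%VS by rewrite spanF memvf.
apply: (scalar_eq0_span (form3_linear3 phi v w)) => e.
by rewrite !inE; do !case/predU1P=> [->//|]; move/eqP->.
Qed.

(** No two-form of the pencil of u and x degenerates on Y.  Indeed, let v be
    x - h u and suppose that y in Y pairs to zero with Y for the two-form of v.
    Adding to y the right multiple of u makes phi(v, y, f) vanish too, and the
    pairings with u and x vanish because Y lies in the kernel of phi(u, x, -);
    so v would be degenerate. *)
Lemma frame_pencil k u x f y1 y2 y3 y4 h c1 c2 c3 c4 : frame k u x f y1 y2 y3 y4 ->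
  let y := c1 *: y1 + c2 *: y2 + c3 *: y3 + c4 *: y4 in
  phi (x - h *: u) y y1 = 0 -> phi (x - h *: u) y y2 = 0 ->
  phi (x - h *: u) y y3 = 0 -> phi (x - h *: u) y y4 = 0 ->
  [/\ c1 = 0, c2 = 0, c3 = 0 & c4 = 0].
Proof.
move=> F y; have [k0 uxf x1 x2 x3 x4 u12 u13 u14 u23 u24 u34] := F.
set v := x - h *: u => vy1 vy2 vy3 vy4.
pose w := y + (phi v y f / k) *: u.
have nfree : ~ free [:: v; w].
  have uvy z : phi u x z = 0 -> phi v w z = phi v y z.
    by move=> uxz; rewrite /w /v; form3_table; ring.
  apply: (frame_zero F); last 4 first; do ?by rewrite uvy.
  - by rewrite /v /w /y; form3_table; ring.
  - by rewrite /v /w /y; form3_table; ring.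
  rewrite /w form3D2 form3Z2 (_ : phi v u f = - k); last first.
    by rewrite /v; form3_table; ring.
  by rewrite mulrN divfK // subrr.
have out z : phi u v z = 0 -> phi u w z = 0.
  move=> uvz; case: (eqVneq (phi u w z) 0) => // uwz; case: nfree.
  apply: (free_pair (l := fun t => phi u t z) (m := fun t => phi u t f)) => //.
  - exact: form3_linear2.
  - exact: form3_linear2.
  - by rewrite /v; form3_table; rewrite mulr0 subr0.
by split; [rewrite -(out y2)|apply: oppr_inj; rewrite oppr0 -(out y1)|rewrite -(out y4)
  |apply: oppr_inj; rewrite oppr0 -(out y3)]; rewrite /v /w /y; form3_table; ring.
Qed.

End Frames.

Section FrameExistence.
Variables (R : realType) (V : vectType R) (phi : form3 V).
Hypothesis dimV : \dim {:V} = 7%N.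
Hypothesis nd_phi : form3_nondegenerate phi.

Lemma exists_notin_span (X : seq V) : (size X < 7)%N -> exists z, z \notin <<X>>%VS.
Proof.
move=> ltX; have : ~~ (fullv <= <<X>>)%VS.
  apply: contraL ltX => /dimvS; rewrite dimV -leqNgt => /leq_trans; apply.
  exact: dim_span.
by case/subvPn => z _ ?; exists z.
Qed.

Lemma free_notin (u w : V) : u != 0 -> w \notin <<[:: u]>>%VS -> free [:: u; w].
Proof.
move=> u0 wNu; rewrite (perm_free (permEl (perm_catC [:: u] [:: w]))).
by rewrite free_cons seq1_free u0 andbT.
Qed.

(** The form phi(u, -, -) descends to the quotient of the kernel of
    phi(u, x, -) by the plane of u and x, and is nondegenerate there. *)
Lemma exists_dual u x f y : phi u x f != 0 -> phi u x y = 0 -> u != 0 ->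
  y \notin <<[:: u; x]>>%VS -> exists2 z, phi u x z = 0 & phi u y z = 1.
Proof.
move=> k0 uxy u0 yNux; pose w := y - (phi u y f / phi u x f) *: x.
have : free [:: u; w].
  apply: free_notin => //; apply: contra yNux => wu.
  rewrite -(@rpredBr _ _ ((phi u y f / phi u x f) *: x)).
    by apply: (subvP _ _ wu); apply: sub_span => e; rewrite !inE => ->.
  by rewrite rpredZ // memv_span // !inE eqxx orbT.
case/nd_phi => z uwz; pose z' := z - (phi u x z / phi u x f) *: f.
have uxz : phi u x z' = 0 by rewrite /z' !form3E divfK // subrr.
have uyz : phi u y z' = phi u w z.
  rewrite /z' /w !form3E; field; exact: k0.
exists ((phi u w z)^-1 *: z'); first by rewrite form3Z3 uxz mulr0.
by rewrite form3Z3 uyz mulVf.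
Qed.

(** Symplectic Gram-Schmidt: pr projects to the kernel of phi(u, x, -) along f,
    and pq to the orthogonal of the hyperbolic plane of y1, y2 for the two-form
    of u. *)
Lemma exists_frame : exists k u x f y1 y2 y3 y4, frame phi k u x f y1 y2 y3 y4.
Proof.
have [u uNnil] := @exists_notin_span [::] isT.
have u0 : u != 0 by rewrite span_nil memv0 in uNnil.
have [x xNu] := @exists_notin_span [:: u] isT.
have [f k0] := nd_phi (free_notin u0 xNu); set k := phi u x f in k0.
pose pr z := z - (phi u x z / k) *: f.
have uxpr z : phi u x (pr z) = 0 by rewrite /pr !form3E -/k divfK // subrr.
have [t1 t1N] := @exists_notin_span [:: u; x; f] isT.
have y1N : pr t1 \notin <<[:: u; x]>>%VS.
  apply: contra t1N => y1in; rewrite -(@rpredBr _ _ ((phi u x t1 / k) *: f)).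
    apply: (subvP _ _ y1in); apply: sub_span => e.
    by rewrite !inE => /orP[]->; rewrite ?orbT.
  by rewrite rpredZ // memv_span // !inE eqxx !orbT.
have [y2 x2 u12] := exists_dual k0 (uxpr _) u0 y1N.
move: (pr t1) (uxpr t1) y1N u12 => y1 x1 y1N u12.
pose pq z := z - phi u z y2 *: y1 - phi u y1 z *: y2.
have xpq z : phi u x z = 0 -> phi u x (pq z) = 0.
  by move=> xz; rewrite /pq; form3_table; ring.
have pq1 z : phi u y1 (pq z) = 0 by rewrite /pq; form3_table; ring.
have pq2 z : phi u y2 (pq z) = 0.
  rewrite /pq; form3_table; rewrite (form3_swap23 _ u z y2); ring.
have [t3 t3N] := @exists_notin_span [:: u; x; f; y1; y2] isT.
have y3N : pq (pr t3) \notin <<[:: u; x]>>%VS.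
  apply: contra t3N => y3in.
  rewrite -(@rpredBr _ _ ((phi u x t3 / k) *: f)); last first.
    by rewrite rpredZ // memv_span // !inE eqxx !orbT.
  rewrite -(@rpredBr _ _ (phi u (pr t3) y2 *: y1)); last first.
    by rewrite rpredZ // memv_span // !inE eqxx !orbT.
  rewrite -(@rpredBr _ _ (phi u y1 (pr t3) *: y2)); last first.
    by rewrite rpredZ // memv_span // !inE eqxx !orbT.
  apply: (subvP _ _ y3in); apply: sub_span => e.
    by rewrite !inE => /orP[]->; rewrite ?orbT.
have x3 := xpq _ (uxpr t3).
have [y4 x4 u34] := exists_dual k0 x3 u0 y3N.
move: (pq (pr t3)) x3 (pq1 (pr t3)) (pq2 (pr t3)) u34 => y3 x3 u13 u23 u34.
exists k, u, x, f, y1, y2, y3, (pq y4); split; rewrite ?xpq ?pq1 ?pq2 //.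
by rewrite /pq; form3_table; ring.
Qed.

End FrameExistence.

(** * Bringing the two-form of x to a standard form *)

Section Pfaffian.
Variables (R : realType) (V : vectType R) (phi : form3 V).
Hypothesis dimV : \dim {:V} = 7%N.
Hypothesis nd_phi : form3_nondegenerate phi.

(** The hypothesis on p says that the two-forms of u and x wedge to zero on Y.
    Let s be the endomorphism of Y that turns the two-form of u into that of x;
    then s^2 is minus the Pfaffian of the latter.  If this Pfaffian were
    - h^2 <= 0, the vector (s + h) y1, whose coordinates are p + h, 0, n, - m,
    would be an eigenvector of s for h, which frame_pencil forbids. *)
Lemma frame_pfaffian k u x f y1 y2 y3 y4 p m n r w : frame phi k u x f y1 y2 y3 y4 ->
  phi x y1 y2 = p -> phi x y3 y4 = - p -> phi x y1 y3 = m -> phi x y1 y4 = n ->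
  phi x y2 y3 = r -> phi x y2 y4 = w ->
  (m != 0) || (n != 0) /\ 0 < n * r - m * w - p ^+ 2.
Proof.
move=> F x12 x34 x13 x14 x23 x24.
have [k0 uxf x1 x2 x3 x4 u12 u13 u14 u23 u24 u34] := F.
have pencil := frame_pencil dimV nd_phi F.
(* Otherwise y1 itself is an eigenvector, for p. *)
have mn0 : (m != 0) || (n != 0).
  rewrite -negb_and; apply/negP => /andP[/eqP m0 /eqP n0].
  have [] := @pencil p 1 0 0 0; last by move/eqP; rewrite oner_eq0.
  - by form3_table; ring.
  - by form3_table; ring.
  - by form3_table; rewrite m0; ring.
  - by form3_table; rewrite n0; ring.
split=> //; rewrite ltNge; apply/negP => pf_le0.
pose h := Num.sqrt (p ^+ 2 + m * w - n * r).
have h2 : h ^+ 2 = p ^+ 2 + m * w - n * r by rewrite sqr_sqrtr //; lra.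
have [] := @pencil h (p + h) 0 n (- m).
- by form3_table; ring.
- form3_table; apply/eqP; rewrite -subr_eq0; apply/eqP.
  by transitivity (p ^+ 2 + m * w - n * r - h ^+ 2); [ring | rewrite h2 subrr].
- by form3_table; ring.
- by form3_table; ring.
by move=> _ _ n0 /eqP; rewrite oppr_eq0 => m0; rewrite n0 eqxx m0 in mn0.
Qed.

End Pfaffian.

Section SecondForm.
Variables (R : realType) (V : vectType R) (phi : form3 V).
Hypothesis dimV : \dim {:V} = 7%N.
Hypothesis nd_phi : form3_nondegenerate phi.

Record frame2 (k : R) (u x f y1 y2 y3 y4 : V) : Prop := Frame2 {
  frame2_frame : frame phi k u x f y1 y2 y3 y4;
  frame_x12 : phi x y1 y2 = 0; frame_x13 : phi x y1 y3 = 0;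
  frame_x14 : phi x y1 y4 = 1; frame_x23 : phi x y2 y3 = 1;
  frame_x24 : phi x y2 y4 = 0; frame_x34 : phi x y3 y4 = 0
}.

(** Equality modulo a relation a = b; given the cofactor c, what remains is a
    ring identity. *)
Lemma eq_of_relation (a b l r c : R) : a = b -> l - r = c * (a - b) -> l = r.
Proof. by move=> ->; rewrite subrr mulr0 => /eqP; rewrite subr_eq0 => /eqP. Qed.

(** Subtracting a multiple of u from x makes the two-forms of u and x wedge to
    zero on Y, and rescaling x makes the Pfaffian of the second one 1. *)
Lemma frame_normalize_x k u x f y1 y2 y3 y4 : frame phi k u x f y1 y2 y3 y4 ->
  exists k' x' p m n r w, frame phi k' u x' f y1 y2 y3 y4 /\
  [/\ phi x' y1 y2 = p, phi x' y3 y4 = - p, phi x' y1 y3 = m &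
  [/\ phi x' y1 y4 = n, phi x' y2 y3 = r, phi x' y2 y4 = w,
      n * r - m * w - p ^+ 2 = 1 & (m != 0) || (n != 0)]].
Proof.
move=> F; have [k0 uxf x1 x2 x3 x4 u12 u13 u14 u23 u24 u34] := F.
set p1 := phi x y1 y2; set p2 := phi x y3 y4; pose p := (p1 - p2) / 2.
pose x0 := x - ((p1 + p2) / 2) *: u.
have F0 : frame phi k u x0 f y1 y2 y3 y4.
  by split=> //; rewrite /x0; form3_table; ring.
have x12 : phi x0 y1 y2 = p by rewrite /x0 form3D1 form3N1 form3Z1 u12 /p -/p1; field.
have x34 : phi x0 y3 y4 = - p by rewrite /x0 form3D1 form3N1 form3Z1 u34 /p -/p2; field.
have [] := frame_pfaffian dimV nd_phi F0 x12 x34 erefl erefl erefl erefl.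
move x13: (phi x0 y1 y3) => m; move x14: (phi x0 y1 y4) => n.
move x23: (phi x0 y2 y3) => r; move x24: (phi x0 y2 y4) => w mn0 pf0.
pose s := (Num.sqrt (n * r - m * w - p ^+ 2))^-1.
have s0 : s != 0 by rewrite invr_eq0 gt_eqF // sqrtr_gt0.
have s2 : s ^+ 2 * (n * r - m * w - p ^+ 2) = 1.
  by rewrite exprVn sqr_sqrtr ?mulVf ?gt_eqF // ltW.
have [_ uxf0 x10 x20 x30 x40 _ _ _ _ _ _] := F0.
exists (s * k), (s *: x0), (s * p), (s * m), (s * n), (s * r), (s * w).
split; first by split; rewrite ?mulf_neq0 // form3Z2 ?uxf0 ?x10 ?x20 ?x30 ?x40 ?mulr0.
do ![split] => //; try by rewrite form3Z1 ?x12 ?x13 ?x14 ?x23 ?x24 ?x34 ?mulrN.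
- by rewrite -[RHS]s2; ring.
- by rewrite !mulf_eq0 (negPf s0).
Qed.

(** With s the complex structure of Y that turns the two-form of u into that of
    x, the new basis is y1, y2, s y1, - s y2, where y2 has been moved to be
    orthogonal to s y1 for the two-form of u. *)
Lemma exists_frame2 : exists k u x f y1 y2 y3 y4, frame2 k u x f y1 y2 y3 y4.
Proof.
have [k1 [u [x1 [f [z1 [z2 [z3 [z4 F1]]]]]]]] := exists_frame dimV nd_phi.
have [k [x [p [m [n [r [w [F]]]]]]]] := frame_normalize_x F1.
case=> x12 x34 x13 [x14 x23 x24 pf1 mn0] {k1 x1 F1}.
have [k0 uxf xz1 xz2 xz3 xz4 u12 u13 u14 u23 u24 u34] := F.
have mn2 : m ^+ 2 + n ^+ 2 != 0.
  by rewrite paddr_eq0 ?sqr_ge0 // !sqrf_eq0 negb_and.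
pose xi := - (p * m) / (m ^+ 2 + n ^+ 2).
pose eta := - (p * n) / (m ^+ 2 + n ^+ 2).
have pxe : p + xi * m + eta * n = 0 by rewrite /xi /eta; field.
exists k, u, x, f, z1, (z2 + xi *: z3 + eta *: z4), (p *: z1 + n *: z3 - m *: z4),
 ((xi * r + eta * w) *: z1 + (xi * p - w) *: z3 + (r + eta * p) *: z4).
split; first split=> //; form3_table; try ring.
- by apply: (eq_of_relation (c := -1) pxe); ring.
- by apply: (eq_of_relation (c := p) pxe); rewrite -[X in _ - X]pf1; ring.
- by apply: (eq_of_relation (c := 1) pxe); ring.
- by apply: (eq_of_relation (c := p) pxe); rewrite -[X in _ - X]pf1; ring.
- by rewrite -[RHS]pf1; ring.
- by apply: (eq_of_relation (c := - (xi * r + eta * w)) pxe); ring.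
Qed.

End SecondForm.

(** * Removing the mixed terms *)

Section ThirdForm.
Variables (R : realType) (V : vectType R) (phi : form3 V).
Hypothesis dimV : \dim {:V} = 7%N.
Hypothesis nd_phi : form3_nondegenerate phi.

Record frame3 (k : R) (u x f y1 y2 y3 y4 : V) : Prop := Frame3 {
  frame3_frame2 : frame2 phi k u x f y1 y2 y3 y4;
  frame_uf1 : phi u f y1 = 0; frame_uf2 : phi u f y2 = 0;
  frame_uf3 : phi u f y3 = 0; frame_uf4 : phi u f y4 = 0;
  frame_xf1 : phi x f y1 = 0; frame_xf2 : phi x f y2 = 0;
  frame_xf3 : phi x f y3 = 0; frame_xf4 : phi x f y4 = 0;
  frame_123 : phi y1 y2 y3 = 0; frame_124 : phi y1 y2 y4 = 0;
  frame_134 : phi y1 y3 y4 = 0; frame_234 : phi y2 y3 y4 = 0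
}.

(** The conditions are twelve linear equations for the shears
    y_i + a_i u + b_i x and f + g1 y1 + ... + g4 y4: the pairings of f with u
    and x give the a_i and the b_i in terms of the g_j, and then each triple of
    the y_i gives one equation 2 g_j = ... *)
Lemma exists_frame3 : exists k u x f y1 y2 y3 y4, frame3 k u x f y1 y2 y3 y4.
Proof.
have [k [u [x [f [y1 [y2 [y3 [y4 F2]]]]]]]] := exists_frame2 dimV nd_phi.
have [F x12 x13 x14 x23 x24 x34] := F2.
have [k0 uxf x1 x2 x3 x4 u12 u13 u14 u23 u24 u34] := F.
move fu1: (phi f u y1) => A1; move fu2: (phi f u y2) => A2.
move fu3: (phi f u y3) => A3; move fu4: (phi f u y4) => A4.
move fx1: (phi f x y1) => C1; move fx2: (phi f x y2) => C2.
move fx3: (phi f x y3) => C3; move fx4: (phi f x y4) => C4.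
move y123: (phi y1 y2 y3) => r123; move y124: (phi y1 y2 y4) => r124.
move y134: (phi y1 y3 y4) => r134; move y234: (phi y2 y3 y4) => r234.
pose g1 := (C4 + A2 + k * r124) / 2; pose g2 := (C3 - A1 + k * r123) / 2.
pose g3 := - (C2 - A4 + k * r234) / 2; pose g4 := - (C1 + A3 + k * r134) / 2.
pose z1 := y1 + ((C1 + g4) / k) *: u - ((g2 + A1) / k) *: x.
pose z2 := y2 + ((C2 + g3) / k) *: u + ((g1 - A2) / k) *: x.
pose z3 := y3 + ((C3 - g2) / k) *: u - ((g4 + A3) / k) *: x.
pose z4 := y4 + ((C4 - g1) / k) *: u + ((g3 - A4) / k) *: x.
exists k, u, x, (f + g1 *: y1 + g2 *: y2 + g3 *: y3 + g4 *: y4), z1, z2, z3, z4.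
split; first split; first split=> //.
all: rewrite /z1 /z2 /z3 /z4; form3_table.
all: try by ring.
all: try by field.
all: by rewrite /g1 /g2 /g3 /g4; field.
Qed.

(** The values required of phi f express that on Y the two-form of f wedges to
    zero with those of u and x; this is reached by adding multiples of u and x
    to f.  Exchanging the roles of x and f, frame_pfaffian shows that its
    Pfaffian is positive, and rescaling f makes it 1. *)
Lemma exists_frame3_primitive : exists k u x f y1 y2 y3 y4 a b c d,
  frame3 k u x f y1 y2 y3 y4 /\
  [/\ phi f y1 y2 = a, phi f y3 y4 = - a, phi f y1 y4 = b, phi f y2 y3 = - b &
  [/\ phi f y1 y3 = c, phi f y2 y4 = d & a ^+ 2 + b ^+ 2 + c * d = - 1]].
Proof.
have [k1 [u [x [f1 [y1 [y2 [y3 [y4 F1]]]]]]]] := exists_frame3.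
have [[F x12 x13 x14 x23 x24 x34]] := F1.
have [k0 uxf x1 x2 x3 x4 u12 u13 u14 u23 u24 u34] := F.
move=> uf1 uf2 uf3 uf4 xf1 xf2 xf3 xf4 y123 y124 y134 y234.
set p1 := phi f1 y1 y2; set p2 := phi f1 y3 y4.
set q1 := phi f1 y1 y4; set q2 := phi f1 y2 y3.
pose f0 := f1 - ((p1 + p2) / 2) *: u - ((q1 + q2) / 2) *: x.
pose a := (p1 - p2) / 2; pose b := (q1 - q2) / 2.
have uxf0 : phi u x f0 = k1 by rewrite /f0; form3_table; ring.
have uf01 : phi u f0 y1 = 0 by rewrite /f0; form3_table; ring.
have uf02 : phi u f0 y2 = 0 by rewrite /f0; form3_table; ring.
have uf03 : phi u f0 y3 = 0 by rewrite /f0; form3_table; ring.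
have uf04 : phi u f0 y4 = 0 by rewrite /f0; form3_table; ring.
have xf01 : phi x f0 y1 = 0 by rewrite /f0; form3_table; ring.
have xf02 : phi x f0 y2 = 0 by rewrite /f0; form3_table; ring.
have xf03 : phi x f0 y3 = 0 by rewrite /f0; form3_table; ring.
have xf04 : phi x f0 y4 = 0 by rewrite /f0; form3_table; ring.
have fE (v w : V) : phi f0 v w = phi f1 v w - (p1 + p2) / 2 * phi u v w
    - (q1 + q2) / 2 * phi x v w by rewrite /f0 !form3D1 !form3N1 !form3Z1.
have f12 : phi f0 y1 y2 = a by rewrite fE -/p1 x12 u12 /a; field.
have f34 : phi f0 y3 y4 = - a by rewrite fE -/p2 x34 u34 /a; field.
have f14 : phi f0 y1 y4 = b by rewrite fE -/q1 x14 u14 /b; field.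
have f23 : phi f0 y2 y3 = - b by rewrite fE -/q2 x23 u23 /b; field.
move f13: (phi f0 y1 y3) => c; move f24: (phi f0 y2 y4) => d.
move: f0 a b fE uxf0 uf01 uf02 uf03 uf04 xf01 xf02 xf03 xf04 f12 f34 f14 f23 f13 f24.
move=> f a b _ uxf0 uf01 uf02 uf03 uf04 xf01 xf02 xf03 xf04 f12 f34 f14 f23 f13 f24.
have Fufx : frame phi (- k1) u f x y1 y2 y3 y4.
  by split=> //; rewrite ?oppr_eq0 //; form3_table.
have [_ pf0] := frame_pfaffian dimV nd_phi Fufx f12 f34 f13 f14 f23 f24.
pose s := (Num.sqrt (b * - b - c * d - a ^+ 2))^-1.
have s0 : s != 0 by rewrite invr_eq0 gt_eqF // sqrtr_gt0.
have s2 : s ^+ 2 * (b * - b - c * d - a ^+ 2) = 1.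
  by rewrite exprVn sqr_sqrtr ?mulVf ?gt_eqF // ltW.
exists (s * k1), u, x, (s *: f), y1, y2, y3, y4, (s * a), (s * b), (s * c), (s * d).
split; last first.
  split; try (by form3_table; ring); split; try (by form3_table; ring).
  by rewrite -s2; ring.
split; first split=> //; first split=> //; form3_table; rewrite ?mulr0 //.
by rewrite mulf_neq0.
Qed.

End ThirdForm.

(** * Existence of Cayley frames *)

Section CayleyFrames.
Variables (R : realType) (V : vectType R).

(** The triple product of the imaginary octonions, for the basis u, v, u v, w,
    u w, v w, (u v) w generated by orthonormal u, v, w with w orthogonal to
    u v. *)
Record cayley_frame (phi : form3 V) (e0 e1 e2 e3 e4 e5 e6 : V) : Prop := CayleyFrame {
  cayley_012 : phi e0 e1 e2 = 1; cayley_013 : phi e0 e1 e3 = 0;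
  cayley_014 : phi e0 e1 e4 = 0; cayley_015 : phi e0 e1 e5 = 0;
  cayley_016 : phi e0 e1 e6 = 0; cayley_023 : phi e0 e2 e3 = 0;
  cayley_024 : phi e0 e2 e4 = 0; cayley_025 : phi e0 e2 e5 = 0;
  cayley_026 : phi e0 e2 e6 = 0; cayley_034 : phi e0 e3 e4 = 1;
  cayley_035 : phi e0 e3 e5 = 0; cayley_036 : phi e0 e3 e6 = 0;
  cayley_045 : phi e0 e4 e5 = 0; cayley_046 : phi e0 e4 e6 = 0;
  cayley_056 : phi e0 e5 e6 = - 1; cayley_123 : phi e1 e2 e3 = 0;
  cayley_124 : phi e1 e2 e4 = 0; cayley_125 : phi e1 e2 e5 = 0;
  cayley_126 : phi e1 e2 e6 = 0; cayley_134 : phi e1 e3 e4 = 0;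
  cayley_135 : phi e1 e3 e5 = 1; cayley_136 : phi e1 e3 e6 = 0;
  cayley_145 : phi e1 e4 e5 = 0; cayley_146 : phi e1 e4 e6 = 1;
  cayley_156 : phi e1 e5 e6 = 0; cayley_234 : phi e2 e3 e4 = 0;
  cayley_235 : phi e2 e3 e5 = 0; cayley_236 : phi e2 e3 e6 = 1;
  cayley_245 : phi e2 e4 e5 = - 1; cayley_246 : phi e2 e4 e6 = 0;
  cayley_256 : phi e2 e5 e6 = 0; cayley_345 : phi e3 e4 e5 = 0;
  cayley_346 : phi e3 e4 e6 = 0; cayley_356 : phi e3 e5 e6 = 0;
  cayley_456 : phi e4 e5 e6 = 0
}.


Lemma cube_root (a : R) : exists s, s ^+ 3 = a.
Proof.
pose p : {poly R} := 'X ^+ 3 - a%:P; pose b := 1 + `|a|.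
have pE s : p.[s] = s ^+ 3 - a by rewrite /p !hornerE.
have b3 : `|a| <= b ^+ 3.
  by rewrite (le_trans (_ : _ <= b)) ?ler_eXnr // /b ?lerDl ?lerDr.
have [||s _ /rootP] := @poly_ivt R p (- b) b.
- by rewrite ge0_cp // addr_ge0.
- rewrite !pE (_ : (- b) ^+ 3 = - b ^+ 3); last by ring.
  have := ler_norm a; have := ler_norm (- a); rewrite normrN => h1 h2.
  by apply/andP; split; lra.
by rewrite pE => /eqP; rewrite subr_eq0 => /eqP; exists s.
Qed.

Hypothesis dimV : \dim {:V} = 7%N.
Variable phi : form3 V.
Hypothesis nd_phi : form3_nondegenerate phi.

(** If c / k < 0, then phi is the split form: for a suitable p the vector
    p u + y1 is null, and phi(p u + y1, -, -) has a second kernel vector,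
    f + p k (y4 - (a / c) y1 - (b / c) y3). *)
Lemma frame3_sign k u x f y1 y2 y3 y4 a b c d : frame3 phi k u x f y1 y2 y3 y4 ->
  phi f y1 y2 = a -> phi f y3 y4 = - a -> phi f y1 y4 = b -> phi f y2 y3 = - b ->
  phi f y1 y3 = c -> phi f y2 y4 = d -> c != 0 -> 0 < c / k.
Proof.
move=> F3 f12 f34 f14 f23 f13 f24 c0.
have [[F x12 x13 x14 x23 x24 x34]] := F3.
have [k0 uxf x1 x2 x3 x4 u12 u13 u14 u23 u24 u34] := F.
move=> uf1 uf2 uf3 uf4 xf1 xf2 xf3 xf4 y123 y124 y134 y234.
rewrite lt_def mulf_neq0 ?invr_eq0 //= leNgt; apply/negP => ck_lt0.
pose p := Num.sqrt (- (c / k)).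
have p2 : p ^+ 2 * k = - c by rewrite sqr_sqrtr ?mulNr ?divfK // oppr_ge0 ltW.
have p0 : p != 0 by rewrite gt_eqF // sqrtr_gt0 oppr_gt0.
pose v := p *: u + y1; pose w := f + (p * k) *: (y4 - (a / c) *: y1 - (b / c) *: y3).
apply: (frame_zero dimV nd_phi (v := v) (w := w) F); last first.
  apply: (free_pair (form3_linear3 phi u x) (form3_linear2 phi u y2));
    by rewrite /v /w; form3_table;
       rewrite ?(oppr0, mulr0, mulr1, subr0, addr0, add0r, oner_eq0).
all: rewrite /v /w; form3_table; try by field.
- by apply: (eq_of_relation (c := - (b / c)) p2); field.
- by apply: (eq_of_relation (c := - 1) p2); field.
- by apply: (eq_of_relation (c := - (a / c)) p2); field.
Qed.

(** With s and t the complex structures of Y that turn the two-form of u into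
    those of x and f, the vectors y1, s t y1, t y1, s y1 form a quaternionic
    basis of Y; up to scale they are the last four vectors below.  The scales l,
    n and 1 / (l n) of the groups (u, x, f), (e4, e5, e6) and e3 have to satisfy
    l^3 k = 1 and l n^2 = c. *)
Lemma exists_cayley_frame :
  exists e0 e1 e2 e3 e4 e5 e6, cayley_frame phi e0 e1 e2 e3 e4 e5 e6.
Proof.
have [k [u [x [f [y1 [y2 [y3 [y4 [a [b [c [d [F3]]]]]]]]]]]]] :=
  exists_frame3_primitive dimV nd_phi.
case=> f12 f34 f14 f23 [f13 f24 pf].
have c0 : c != 0.
  apply/eqP => c0; move: pf; rewrite c0 mul0r addr0 => pf.
  by have := addr_ge0 (sqr_ge0 a) (sqr_ge0 b); rewrite pf oppr_ge0 leNgt ltr01.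
have ck := frame3_sign F3 f12 f34 f14 f23 f13 f24 c0.
have [[F x12 x13 x14 x23 x24 x34]] := F3.
have [k0 uxf x1 x2 x3 x4 u12 u13 u14 u23 u24 u34] := F.
move=> uf1 uf2 uf3 uf4 xf1 xf2 xf3 xf4 y123 y124 y134 y234.
have [l l3] := cube_root k^-1.
have l0 : l != 0 by apply: contraNneq k0 => l0; rewrite -invr_eq0 -l3 l0 expr0n.
have l3k : l ^+ 3 * k = 1 by rewrite l3 mulVf.
have cl : 0 < c / l.
  have -> : c / l = c / k * l ^- 4 by rewrite -l3; field; rewrite l0.
  by rewrite mulr_gt0 // invr_gt0 exprn_even_gt0.
pose n := Num.sqrt (c / l).
have n0 : n != 0 by rewrite gt_eqF // sqrtr_gt0.
have ln2 : l * n ^+ 2 = c by rewrite sqr_sqrtr ?ltW // mulrC divfK.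
exists (l *: u), (l *: x), (l *: f), ((l * n)^-1 *: y1),
  (n *: (y2 + (b / c) *: y1 - (a / c) *: y3)),
  (n *: (y4 - (a / c) *: y1 - (b / c) *: y3)), ((n / c) *: y3).
split; form3_table.
all: try by ring.
all: try by field; rewrite ?l0 ?n0 ?c0.
all: try by rewrite -[RHS]l3k; ring.
- by apply: (eq_of_relation (c := - c^-1) ln2); field.
- by apply: (eq_of_relation (c := c^-1) ln2); field.
- transitivity (l * n ^+ 2 / c * (a ^+ 2 + b ^+ 2 + c * d)); first by field.
  by rewrite ln2 pf divff // mul1r.
Qed.

End CayleyFrames.

(** * Coordinates in a Cayley frame *)

Section CayleyModel.
Variable R : realType.
Implicit Types x y z : nat -> R.

Definition det3 x y z (i j k : nat) : R :=
  x i * (y j * z k - y k * z j) - x j * (y i * z k - y k * z i)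
  + x k * (y i * z j - y j * z i).

Definition cayley_form x y z : R :=
  det3 x y z 0 1 2 + det3 x y z 0 3 4 + det3 x y z 1 3 5 + det3 x y z 2 3 6
  - det3 x y z 0 5 6 + det3 x y z 1 4 6 - det3 x y z 2 4 5.

Definition dot7 x y : R :=
  x 0 * y 0 + x 1 * y 1 + x 2 * y 2 + x 3 * y 3 + x 4 * y 4 + x 5 * y 5 + x 6 * y 6.

Definition cayley_cross x y (k : nat) : R := cayley_form x y (fun i => (i == k)%:R).

(** The multiplicativity of the octonion norm, for imaginary octonions. *)
Lemma cayley_cross_norm x y :
  dot7 (cayley_cross x y) (cayley_cross x y)
  = dot7 x x * dot7 y y - dot7 x y ^+ 2.
Proof. by rewrite /dot7 /cayley_cross /cayley_form /det3 /=; ring. Qed.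

End CayleyModel.

Section CayleyExpansion.
Variables (R : realType) (V : vectType R).
Hypothesis dimV : \dim {:V} = 7%N.
Variables (phi : form3 V) (e0 e1 e2 e3 e4 e5 e6 : V).
Hypothesis C : cayley_frame phi e0 e1 e2 e3 e4 e5 e6.

Definition comb7 (x : nat -> R) : V :=
  x 0 *: e0 + x 1 *: e1 + x 2 *: e2 + x 3 *: e3 + x 4 *: e4 + x 5 *: e5 + x 6 *: e6.

Lemma cayley_comb7 x y z : phi (comb7 x) (comb7 y) (comb7 z) = cayley_form x y z.
Proof.
case: C; do 35 move=> ?.
have E v w : phi v w (comb7 z) = z 0 * phi v w e0 + z 1 * phi v w e1 +
   z 2 * phi v w e2 + z 3 * phi v w e3 + z 4 * phi v w e4 + z 5 * phi v w e5 +
   z 6 * phi v w e6.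
  by rewrite /comb7 !form3D3 !form3Z3.
rewrite {}E /comb7; form3_table.
rewrite /cayley_form /det3; ring.
Qed.

End CayleyExpansion.

(** * From a Cayley frame to an inner product *)

Section DotCalculus.
Variables (R : realType) (V : vectType R) (g : {dot V for idfun}).

Lemma dotC u v : g u v = g v u.
Proof. by rewrite hermC expr0 mul1r. Qed.

Lemma dotDl u v w : g (u + v) w = g u w + g v w.
Proof. exact: linearDl. Qed.

Lemma dotDr u v w : g w (u + v) = g w u + g w v.
Proof. exact: linearDr. Qed.

Lemma dotNl u w : g (- u) w = - g u w.
Proof. exact: linearNl. Qed.

Lemma dotNr u w : g w (- u) = - g w u.
Proof. exact: linearNr. Qed.

Lemma dotZl a u w : g (a *: u) w = a * g u w.
Proof. exact: linearZl_LR. Qed.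

Lemma dotZr a u w : g w (a *: u) = a * g w u.
Proof. exact: linearZr_LR. Qed.

Definition dotE := (dotDl, dotDr, dotNl, dotNr, dotZl, dotZr).

Lemma dot_gt0 u : u != 0 -> 0 < g u u.
Proof. exact: neq0_dnorm_gt0. Qed.

Lemma dot_inj u v : (forall w, g u w = g v w) -> u = v.
Proof.
move=> guv; apply/eqP; rewrite -subr_eq0; apply: contraT => /dot_gt0.
by rewrite dotDl dotNl guv subrr ltxx.
Qed.

(** A map that represents phi through g is bilinear, skew and orthogonal to its
    arguments because phi is an alternating form; only the norm identity is a
    condition. *)
Lemma compatible_of_norm (phi : form3 V) (cr : V -> V -> V) :
  (forall u v w, g (cr u v) w = phi u v w) ->
  (forall u v, g (cr u v) (cr u v) = g u u * g v v - g u v ^+ 2) ->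
  compatible g phi.
Proof.
move=> gcr norm_cr; exists cr; split=> //; split=> // [v a x y|u a x y|u v|u v|u v].
- by apply: dot_inj => w; rewrite dotDl dotZl !gcr !form3E.
- by apply: dot_inj => w; rewrite dotDl dotZl !gcr !form3E.
- by apply: dot_inj => w; rewrite dotNl !gcr form3_swap12.
- by rewrite gcr form3_alt13.
- by rewrite gcr form3_alt23.
Qed.

End DotCalculus.

Section CayleyCoordinates.
Variables (R : realType) (V : vectType R).
Hypothesis dimV : \dim {:V} = 7%N.
Variables (phi : form3 V) (e0 e1 e2 e3 e4 e5 e6 : V).
Hypothesis C : cayley_frame phi e0 e1 e2 e3 e4 e5 e6.

Let comb x := comb7 e0 e1 e2 e3 e4 e5 e6 x.

(** Each vector of the frame is, up to sign, the cross product of two others: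
    the pairing of these with phi gives its coordinate. *)
Definition cayley_coord (v : V) (i : nat) : R :=
  match i with
  | 0 => phi e1 e2 v | 1 => phi e2 e0 v | 2 => phi e0 e1 v | 3 => phi e4 e0 v
  | 4 => phi e0 e3 v | 5 => phi e1 e3 v | 6 => phi e2 e3 v | _ => 0
  end.

Lemma cayley_coordD a u v i :
  cayley_coord (a *: u + v) i = a * cayley_coord u i + cayley_coord v i.
Proof. by case: i => [|[|[|[|[|[|[|i]]]]]]] /=; rewrite ?form3E ?mulr0 ?addr0. Qed.

Lemma cayley_coord_comb x i : (i < 7)%N -> cayley_coord (comb x) i = x i.
Proof.
by case: C; do 35 move=> ?; case: i => [|[|[|[|[|[|[|//]]]]]]] _ /=;
  rewrite /comb /comb7; form3_table; ring.
Qed.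

Lemma cayley_basis : basis_of {:V} [:: e0; e1; e2; e3; e4; e5; e6].
Proof.
apply: free7_basis => //; apply: free7 => c0 c1 c2 c3 c4 c5 c6 s0.
pose x := nth 0 [:: c0; c1; c2; c3; c4; c5; c6].
have xi0 i : (i < 7)%N -> x i = 0.
  move=> lti; rewrite -(cayley_coord_comb x lti) [comb x]s0.
  by case: i {lti} => [|[|[|[|[|[|[|i]]]]]]] //=; rewrite (form3_orient (form3_0 phi _ _)).
by do !split; [exact: (xi0 0)|exact: (xi0 1)|exact: (xi0 2)|exact: (xi0 3)
  |exact: (xi0 4)|exact: (xi0 5)|exact: (xi0 6)].
Qed.

Lemma cayley_coordK v : comb (cayley_coord v) = v.
Proof.
have [x ->] : exists x, v = comb x.
  have vin : v \in <<[tuple e0; e1; e2; e3; e4; e5; e6]>>%VS.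
    by rewrite (span_basis cayley_basis) memvf.
  exists (fun i => coord [tuple e0; e1; e2; e3; e4; e5; e6] (inord i) v).
  rewrite {1}(coord_span vin) !big_ord_recl big_ord0 /= addr0 !addrA /comb /comb7.
  by congr (_ *: _ + _ *: _ + _ *: _ + _ *: _ + _ *: _ + _ *: _ + _ *: _);
    congr coord; apply: val_inj; rewrite /= inordK.
by rewrite /comb /comb7 !cayley_coord_comb.
Qed.

Lemma cayley_formE u v w :
  phi u v w = cayley_form (cayley_coord u) (cayley_coord v) (cayley_coord w).
Proof.
rewrite -(cayley_comb7 C (cayley_coord u) (cayley_coord v) (cayley_coord w)).
by rewrite -!/(comb _) !cayley_coordK.
Qed.

Definition cayley_dot (u v : V) : R := dot7 (cayley_coord u) (cayley_coord v).

Lemma cayley_dot_bilinear : bilinear_for *%R (idfun \; *%R) cayley_dot.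
Proof.
by split=> u a v w; rewrite /cayley_dot /dot7 !cayley_coordD /=; ring.
Qed.

Lemma cayley_dot_sym u v : cayley_dot u v = (-1) ^+ false * idfun (cayley_dot v u).
Proof. by rewrite /cayley_dot /dot7 /= expr0; ring. Qed.

Lemma cayley_dot_gt0 u : u != 0 -> 0 < cayley_dot u u.
Proof.
rewrite lt_def /cayley_dot /dot7 => u0.
have sq_ge0 i : 0 <= cayley_coord u i * cayley_coord u i by rewrite -expr2 sqr_ge0.
rewrite !addr_ge0 // andbT; apply: contra u0.
rewrite !paddr_eq0 ?addr_ge0 // !mulf_eq0 !orbb -!andbA.
case/and5P=> /eqP c0 /eqP c1 /eqP c2 /eqP c3 /and3P[/eqP c4 /eqP c5 /eqP c6].
rewrite -(cayley_coordK u) /comb /comb7 c0 c1 c2 c3 c4 c5 c6.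
by rewrite !scale0r !addr0.
Qed.

Lemma cayley_compatible : exists g : {dot V for idfun}, compatible g phi.
Proof.
pose bil := bilinear_isBilinear.Build R V V R *%R (idfun \; *%R) cayley_dot
  cayley_dot_bilinear.
pose her := isHermitianSesquilinear.Build R V false idfun cayley_dot cayley_dot_sym.
pose pos := isDotProduct.Build R V cayley_dot cayley_dot_gt0.
pose g : {dot V for idfun} := HB.pack cayley_dot bil her pos.
exists g; have gE u v : g u v = cayley_dot u v by [].
pose cr u v := comb (cayley_cross (cayley_coord u) (cayley_coord v)).
have coord_cr u v i : (i < 7)%N ->
    cayley_coord (cr u v) i = cayley_cross (cayley_coord u) (cayley_coord v) i.
  exact: cayley_coord_comb.
have gcr u v w : g (cr u v) w = phi u v w.
  rewrite gE /cayley_dot cayley_formE /dot7 !coord_cr //.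
  by rewrite /cayley_cross /cayley_form /det3 /=; ring.
apply: (compatible_of_norm gcr) => u v.
by rewrite !gE /cayley_dot /dot7 !coord_cr //; apply: cayley_cross_norm.
Qed.

End CayleyCoordinates.

(** * Cayley frames and automorphisms *)

Section CayleyIsomorphism.
Variables (R : realType) (V : vectType R).
Hypothesis dimV : \dim {:V} = 7%N.

Lemma cayley_iso (phi phi' : form3 V) e0 e1 e2 e3 e4 e5 e6 d0 d1 d2 d3 d4 d5 d6 :
  cayley_frame phi e0 e1 e2 e3 e4 e5 e6 -> cayley_frame phi' d0 d1 d2 d3 d4 d5 d6 ->
  exists f : 'End(V), [/\ bijective f, f e0 = d0, f e1 = d1, f e3 = d3
    & forall x y z, phi' (f x) (f y) (f z) = phi x y z].
Proof.
move=> C D.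
pose X := cayley_coord phi e0 e1 e2 e3 e4; pose Y := cayley_coord phi' d0 d1 d2 d3 d4.
pose F v := comb7 d0 d1 d2 d3 d4 d5 d6 (X v).
pose G v := comb7 e0 e1 e2 e3 e4 e5 e6 (Y v).
have linF : linear F.
  move=> a u v; rewrite /F /comb7 /X !cayley_coordD !scalerDr.
  by do 6 (rewrite [RHS]addrACA; congr (_ + _); last by rewrite scalerDl scalerA);
     rewrite scalerDl scalerA.
have FK : cancel F G.
  move=> v; rewrite -[RHS](cayley_coordK dimV C) /G /comb7.
  by rewrite /Y /F !(cayley_coord_comb D).
have GK : cancel G F.
  move=> v; rewrite -[RHS](cayley_coordK dimV D) /F /comb7.
  by rewrite /X /G !(cayley_coord_comb C).
pose FL : {linear V -> V} := HB.pack F (GRing.isLinear.Build R V V *:%R F linF).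
exists (linfun FL).
have fE v : linfun FL v = F v by rewrite lfunE.
split.
- by exists G => v; rewrite fE ?FK ?GK.
- rewrite fE /F /comb7 /X /=; case: C; do 35 move=> ?; form3_table.
  by rewrite ?oppr0 ?scale0r ?scale1r ?addr0 ?add0r.
- rewrite fE /F /comb7 /X /=; case: C; do 35 move=> ?; form3_table.
  by rewrite ?oppr0 ?scale0r ?scale1r ?addr0 ?add0r.
- rewrite fE /F /comb7 /X /=; case: C; do 35 move=> ?; form3_table.
  by rewrite ?oppr0 ?scale0r ?scale1r ?addr0 ?add0r.
- by move=> x y z; rewrite !fE /F (cayley_comb7 D) (cayley_formE dimV C).
Qed.

End CayleyIsomorphism.

(** * From an inner product to Cayley frames *)

Section CrossProductIdentities.
Variables (R : realType) (V : vectType R) (g : {dot V for idfun}).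
Variables (phi : form3 V) (cr : V -> V -> V).
Hypothesis gcr : forall u v w, g (cr u v) w = phi u v w.
Hypothesis cross : cross_product g cr.

Lemma crossC u v : cr u v = - cr v u.
Proof. exact: cross_skew cross u v. Qed.

Lemma crossDl u v w : cr (u + v) w = cr u w + cr v w.
Proof. by have := cross_linearl cross w 1 u v; rewrite !scale1r. Qed.

Lemma crossDr u v w : cr u (v + w) = cr u v + cr u w.
Proof. by have := cross_linearr cross u 1 v w; rewrite !scale1r. Qed.

Lemma crossNr u v : cr u (- v) = - cr u v.
Proof. by apply: (dot_inj (g := g)) => w; rewrite dotNl !gcr form3N2. Qed.

Lemma cross_dot u v w : g (cr u v) (cr u w) = g u u * g v w - g u v * g u w.
Proof.
have := cross_norm cross u (v + w); have := cross_norm cross u v.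
have := cross_norm cross u w.
rewrite crossDr !dotE [g w v]dotC [g (cr u w) (cr u v)]dotC !expr2; lra.
Qed.

Lemma cross_cross u v : cr u (cr u v) = g u v *: u - g u u *: v.
Proof.
apply: (dot_inj (g := g)) => w.
by rewrite gcr form3_swap23 -gcr cross_dot !dotE [g w v]dotC; ring.
Qed.

(** The polarization in u of cross_cross. *)
Lemma cross_cross_polar u v w :
  cr u (cr v w) + cr v (cr u w) = g u w *: v + g v w *: u - (2 * g u v) *: w.
Proof.
apply: (dot_inj (g := g)) => z; have := congr1 (g^~ z) (cross_cross (u + v) w).
rewrite /= !crossDl !crossDr !cross_cross !dotE [g v u]dotC; lra.
Qed.

(** The vector u x v witnesses nondegeneracy: if it vanished, cross_cross would
    express v as a multiple of u. *)
Lemma compatible_nondegenerate : form3_nondegenerate phi.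
Proof.
move=> u v uv; exists (cr u v); rewrite -gcr.
have u0 : u != 0.
  by apply: contraTneq uv => ->; rewrite free_cons mem0v.
apply: contraTneq uv => guv; rewrite (perm_free (permEl (perm_catC [:: u] [:: v]))).
rewrite /= free_cons seq1_free u0 andbT span_seq1 negbK; apply/vlineP.
have cr0 : cr u v = 0.
  by apply/eqP; apply: contraT => /(dot_gt0 g); rewrite guv ltxx.
have := cross_cross u v; rewrite cr0 (_ : cr u 0 = 0); last first.
  by rewrite -[0](scale0r (0 : V)); apply: (dot_inj (g := g)) => w;
     rewrite gcr form3Z2 dotZl !mul0r.
move=> /esym/eqP; rewrite subr_eq0 => /eqP uv_dep.
exists (g u v / g u u).
by rewrite mulrC -scalerA uv_dep scalerA mulVf ?scale1r // gt_eqF ?dot_gt0.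
Qed.

End CrossProductIdentities.

Section CayleyOfCrossProduct.
Variables (R : realType) (V : vectType R) (g : {dot V for idfun}).
Variables (phi : form3 V) (cr : V -> V -> V).
Hypothesis gcr : forall u v w, g (cr u v) w = phi u v w.
Hypothesis cross : cross_product g cr.

(** For pairwise orthogonal a, b, c, cross_cross_polar reads
    a x (b x c) = - b x (a x c); together with a x (a x b) = - b for orthonormal
    a, b, this computes the products of the seven vectors, and phi is read off
    as g(a x b, c). *)
Lemma cayley_of_orthonormal u v w :
  g u u = 1 -> g v v = 1 -> g w w = 1 -> g u v = 0 -> g u w = 0 -> g v w = 0 ->
  phi u v w = 0 ->
  cayley_frame phi u v (cr u v) w (cr u w) (cr v w) (cr (cr u v) w).
Proof.
move=> uu vv ww uv uw vw uvw.
have vu : g v u = 0 by rewrite dotC.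
have wu : g w u = 0 by rewrite dotC.
have wv : g w v = 0 by rewrite dotC.
have cc := cross_cross gcr cross; have ccp := cross_cross_polar gcr cross.
have unit_cc a b : g a a = 1 -> g a b = 0 -> cr a (cr a b) = - b.
  by move=> aa ab; rewrite cc ab aa scale0r scale1r sub0r.
have unit_cc' a b : g a a = 1 -> g a b = 0 -> cr a (cr b a) = b.
  by move=> aa ab; rewrite (crossC cross b) (crossNr gcr) unit_cc ?opprK.
have anti a b c : g a b = 0 -> g a c = 0 -> g b c = 0 ->
    cr a (cr b c) = - cr b (cr a c).
  move=> ab ac bc; apply/eqP; rewrite -addr_eq0 ccp ab ac bc.
  by rewrite mulr0 !scale0r !addr0 subr0.
have dot1 a b : g a a = 1 -> g b b = 1 -> g a b = 0 -> g (cr a b) (cr a b) = 1.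
  by move=> aa bb ab; rewrite (cross_norm cross) aa bb ab expr2 mulr0 mulr1 subr0.
have dotl a b c : g a b = 0 -> g b c = 0 -> g (cr a b) (cr a c) = 0.
  by move=> ab bc; rewrite (cross_dot cross) ab bc mulr0 mul0r subr0.
have dotr a b c : g a b = 0 -> g b c = 0 -> g (cr b a) (cr c a) = 0.
  by move=> ab bc; rewrite !(crossC cross _ a) dotNl dotNr opprK dotl.
move E2: (cr u v) => e2; move E4: (cr u w) => e4; move E5: (cr v w) => e5.
have g2u : g e2 u = 0 by rewrite -E2 gcr form3_alt13.
have g2v : g e2 v = 0 by rewrite -E2 gcr form3_alt23.
have g2w : g e2 w = 0 by rewrite -E2 gcr.
have g22 : g e2 e2 = 1 by rewrite -E2 dot1.
have g4u : g e4 u = 0 by rewrite -E4 gcr form3_alt13.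
have g4v : g e4 v = 0 by rewrite -E4 gcr form3_swap23 uvw oppr0.
have g4w : g e4 w = 0 by rewrite -E4 gcr form3_alt23.
have g24 : g e2 e4 = 0 by rewrite -E2 -E4 dotl.
have g44 : g e4 e4 = 1 by rewrite -E4 dot1.
have g5u : g e5 u = 0 by rewrite -E5 gcr (form3_orient uvw).
have g5v : g e5 v = 0 by rewrite -E5 gcr form3_alt13.
have g5w : g e5 w = 0 by rewrite -E5 gcr form3_alt23.
have g25 : g e2 e5 = 0 by rewrite -E2 (crossC cross) dotNl -E5 dotl ?oppr0.
have g45 : g e4 e5 = 0 by rewrite -E4 -E5 dotr.
have g55 : g e5 e5 = 1 by rewrite -E5 dot1.
have c02 : cr u e2 = - v by rewrite -E2 unit_cc.
have c12 : cr v e2 = u by rewrite -E2 unit_cc'.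
have c04 : cr u e4 = - w by rewrite -E4 unit_cc.
have c15 : cr v e5 = - w by rewrite -E5 unit_cc.
have c34 : cr w e4 = u by rewrite -E4 unit_cc'.
have c35 : cr w e5 = v by rewrite -E5 unit_cc'.
have c05 : cr u e5 = - cr e2 w.
  by rewrite (crossC cross e2) opprK -E2 anti // (crossC cross w) (crossNr gcr) opprK E5.
have c14 : cr v e4 = cr e2 w by rewrite -E4 anti // E5 c05 opprK.
have c25 : cr e2 e5 = - cr v (cr e2 w) by rewrite -E5 anti.
have c24 : cr e2 e4 = - cr u (cr e2 w) by rewrite -E4 anti.
have g6u : g (cr e2 w) u = 0 by rewrite -[cr e2 w]opprK -c05 dotNl gcr form3_alt13 oppr0.
have g6v : g (cr e2 w) v = 0 by rewrite -c14 gcr form3_alt13.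
have g6w : g (cr e2 w) w = 0 by rewrite gcr form3_alt23.
have g62 : g (cr e2 w) e2 = 0 by rewrite gcr form3_alt13.
have gw2 : g w e2 = 0 by rewrite dotC.
have g64 : g (cr e2 w) e4 = 0 by rewrite -E4 dotr.
have g65 : g (cr e2 w) e5 = 0 by rewrite -E5 dotr.
have g66 : g (cr e2 w) (cr e2 w) = 1 by rewrite dot1.
move E6: (cr e2 w) => e6 in c05 c14 c25 c24 g6u g6v g6w g62 g64 g65 g66 *.
have c06 : cr u e6 = e5 by rewrite -[e6]opprK -c05 (crossNr gcr) unit_cc ?opprK // dotC.
have c16 : cr v e6 = - e4 by rewrite -c14 unit_cc // dotC.
rewrite {}c06 in c24; rewrite {}c16 opprK in c25.
have c45 : cr e4 e5 = - e2.
  by rewrite -[e5]opprK -c24 (crossNr gcr) unit_cc' // dotC.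
split; rewrite // -gcr.
all: rewrite ?(E2, E4, E5, E6, c02, c12, c04, c15, c34, c35, c05, c14, c24, c25, c45) ?dotNl.
all: rewrite ?(dotC g u, dotC g v) //.
all: rewrite ?wv ?g4v ?g5v ?g6v ?g55 ?g66 ?oppr0 //.
all: by rewrite dotC ?g45 ?g5w ?g6w ?g62 ?g64 ?g65 ?oppr0.
Qed.
End CayleyOfCrossProduct.

(** * Uniqueness of the compatible inner product *)

Section Uniqueness.
Variables (R : realType) (V : vectType R).
Hypothesis dimV : \dim {:V} = 7%N.

Lemma exists_orthonormal (g : {dot V for idfun}) (a b c : V) :
  g a a = 1 -> g b b = 1 -> g c c = 1 -> g a b = 0 -> g a c = 0 -> g b c = 0 ->
  exists d, [/\ g d d = 1, g d a = 0, g d b = 0 & g d c = 0].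
Proof.
move=> aa bb cc ab ac bc.
have [z zN] := exists_notin_span dimV (isT : size [:: a; b; c] < 7)%N.
pose d := z - g z a *: a - g z b *: b - g z c *: c.
have d0 : d != 0.
  apply: contraNneq zN => d0.
  have mem_sp e t : e \in [:: a; b; c] -> t *: e \in <<[:: a; b; c]>>%VS.
    by move=> /memv_span /rpredZ; apply.
  rewrite -(@rpredBr _ _ (g z a *: a)) ?mem_sp ?inE ?eqxx //.
  rewrite -(@rpredBr _ _ (g z b *: b)) ?mem_sp ?inE ?eqxx ?orbT //.
  rewrite -(@rpredBr _ _ (g z c *: c)) ?mem_sp ?inE ?eqxx ?orbT //.
  by rewrite -/d d0 mem0v.
have da : g d a = 0 by rewrite /d !dotE aa (dotC g b) ab (dotC g c) ac; ring.
have db : g d b = 0 by rewrite /d !dotE bb ab (dotC g c) bc; ring.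
have dc : g d c = 0 by rewrite /d !dotE cc ac bc; ring.
have gd := dot_gt0 g d0; pose s := (Num.sqrt (g d d))^-1.
have s2 : s * (s * g d d) = 1.
  by rewrite mulrA -expr2 exprVn sqr_sqrtr ?mulVf ?gt_eqF // ltW.
by exists (s *: d); rewrite !dotZl !dotZr da db dc s2 !mulr0.
Qed.

Section Frame.
Variables (g : {dot V for idfun}) (phi : form3 V) (cr : V -> V -> V).
Hypothesis gcr : forall u v w, g (cr u v) w = phi u v w.
Hypothesis cross : cross_product g cr.

(** The products e3 x e6 and e0 x e6 equal e0 x e1 and e1 x e3, because these
    have the same pairings with the frame.  The e6-components of the two sides of
    cross_cross_polar for e0, e3, e6 are then 0 and - 2 g(e0, e3). *)
Lemma cayley_orthogonal e0 e1 e2 e3 e4 e5 e6 :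
  cayley_frame phi e0 e1 e2 e3 e4 e5 e6 -> g e0 e3 = 0.
Proof.
move=> C.
have dot_ext u v : (forall e, e \in [:: e0; e1; e2; e3; e4; e5; e6] -> g u e = g v e) ->
    u = v.
  move=> H; apply: (dot_inj (g := g)) => w; apply/eqP; rewrite -subr_eq0; apply/eqP.
  have : w \in <<[:: e0; e1; e2; e3; e4; e5; e6]>>%VS.
    by rewrite (span_basis (cayley_basis dimV C)) memvf.
  apply: (scalar_eq0_span (l := fun z => g u z - g v z)).
    by move=> a x y; rewrite !dotE; ring.
  by move=> e ein; rewrite H // subrr.
have c36 : cr e3 e6 = cr e0 e1.
  by apply: dot_ext => e; rewrite !inE !gcr; case: C; do 35 move=> ?;
     do !case/predU1P=> [->|]; last move/eqP->; form3_table; rewrite ?opprK ?oppr0.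
have c06 : cr e0 e6 = cr e1 e3.
  by apply: dot_ext => e; rewrite !inE !gcr; case: C; do 35 move=> ?;
     do !case/predU1P=> [->|]; last move/eqP->; form3_table; rewrite ?opprK ?oppr0.
have := cross_cross_polar gcr cross e0 e3 e6.
rewrite c36 c06 (crossC cross e1 e3) (crossNr gcr) !(cross_cross gcr cross).
move/(congr1 (fun z => cayley_coord phi e0 e1 e2 e3 e4 z 6)) => /=.
case: C; do 35 move=> ?; form3_table; lra.
Qed.

End Frame.

Lemma orthogonal_transfer (g1 g2 : {dot V for idfun}) (phi : form3 V) u w :
  compatible g1 phi -> compatible g2 phi -> g1 u w = 0 -> g2 u w = 0.
Proof.
move=> [cr1 [gcr1 X1]] [cr2 [gcr2 X2]].
(* An orthonormal pair a, b is completed to a Cayley frame by a vector d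
   orthogonal to a, b and a x b; a and b sit at the places of e0 and e3. *)
have unit_case a b : g1 a a = 1 -> g1 b b = 1 -> g1 a b = 0 -> g2 a b = 0.
  move=> aa bb ab; have cc : g1 (cr1 a b) (cr1 a b) = 1.
    by rewrite (cross_norm X1) aa bb ab expr2 mulr0 mulr1 subr0.
  have ac : g1 a (cr1 a b) = 0 by rewrite dotC (cross_orthol X1).
  have bc : g1 b (cr1 a b) = 0 by rewrite dotC (cross_orthor X1).
  have [d [dd da db dc]] := exists_orthonormal aa bb cc ab ac bc.
  have adb : phi a d b = 0 by rewrite form3_swap23 -gcr1 dotC dc oppr0.
  have ad : g1 a d = 0 by rewrite dotC.
  have F := cayley_of_orthonormal gcr1 X1 aa dd bb ad ab db adb.
  exact: (cayley_orthogonal gcr2 X2 F).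
move=> uw; have [->|u0] := eqVneq u 0; first exact: linear0l.
have [->|w0] := eqVneq w 0; first exact: linear0r.
have sq z : z != 0 -> exists2 s, s != 0 & g1 (s *: z) (s *: z) = 1.
  move=> z0; have gz := dot_gt0 g1 z0; exists (Num.sqrt (g1 z z))^-1.
    by rewrite invr_eq0 gt_eqF // sqrtr_gt0.
  by rewrite dotZl dotZr mulrA -expr2 exprVn sqr_sqrtr ?mulVf ?gt_eqF // ltW.
have [s s0 us] := sq u u0; have [t t0 wt] := sq w w0.
have := unit_case _ _ us wt; rewrite !dotZl !dotZr uw !mulr0 => /(_ erefl)/eqP.
by rewrite !mulf_eq0 (negPf s0) (negPf t0) => /eqP.
Qed.

(** For any x and y, the vector g1(x, x) y - g1(x, y) x is g1-orthogonal to x;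
    hence g2(x, x) / g1(x, x) takes the same value at any two vectors that are
    not g1-orthogonal, and orthogonal x, y are both compared with x + y. *)
Lemma orthogonal_proportional (g1 g2 : {dot V for idfun}) :
  (forall u w, g1 u w = 0 -> g2 u w = 0) ->
  forall x u w, x != 0 -> g2 u w = g2 x x / g1 x x * g1 u w.
Proof.
move=> transfer.
have rel x y : g1 x x * g2 x y = g1 x y * g2 x x.
  apply/eqP; rewrite -subr_eq0; apply/eqP.
  have := transfer x (g1 x x *: y - g1 x y *: x).
  by rewrite !dotE => -> //; ring.
have gx x : x != 0 -> g1 x x != 0 by move=> /(dot_gt0 g1) /gt_eqF ->.
have ratio x y : g1 x y != 0 -> x != 0 -> y != 0 -> g2 x x / g1 x x = g2 y y / g1 y y.
  move=> xy x0 y0; have := rel x y; have := rel y x.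
  rewrite (dotC g1 y x) (dotC g2 y x) => relyx relxy.
  apply/eqP; rewrite eqr_div ?gx //; apply/eqP; apply: (mulIf xy).
  transitivity (g1 y y * (g1 x y * g2 x x)); first by ring.
  by rewrite -relxy mulrCA relyx; ring.
move=> x u w x0.
have ratio_all y : y != 0 -> g2 x x / g1 x x = g2 y y / g1 y y.
  move=> y0; have [xy|xy] := eqVneq (g1 x y) 0; last exact: ratio.
  have xxy : g1 x (x + y) != 0 by rewrite dotDr xy addr0 gx.
  have yxy : g1 (x + y) y != 0 by rewrite dotDl xy add0r gx.
  have xy0 : x + y != 0 by apply: contraNneq xxy => ->; rewrite linear0r.
  by rewrite (ratio x (x + y)) // (ratio (x + y) y).
have [->|u0] := eqVneq u 0; first by rewrite !linear0l mulr0.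
by rewrite (ratio_all u u0); apply: (mulfI (gx u u0)); rewrite rel; field; apply: gx.
Qed.

(** If g2 = l g1, then the first cross product is l times the second one, and
    the norm identities of the two differ by the factor l^3. *)
Lemma compatible_unique (g1 g2 : {dot V for idfun}) (phi : form3 V) :
  compatible g1 phi -> compatible g2 phi -> forall u v, g1 u v = g2 u v.
Proof.
move=> C1 C2.
have [x xN] := exists_notin_span dimV (isT : size ([::] : seq V) < 7)%N.
have x0 : x != 0 by rewrite span_nil memv0 in xN.
have [y yN] := exists_notin_span dimV (isT : size [:: x] < 7)%N.
have xy := free_notin x0 yN.
pose l := g2 x x / g1 x x.
have l_gt0 : 0 < l by rewrite divr_gt0 ?dot_gt0.
have g2E u w : g2 u w = l * g1 u w.
  exact: orthogonal_proportional (fun u w => orthogonal_transfer C1 C2) _ _ _ x0.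
have [cr1 [gcr1 X1]] := C1; have [cr2 [gcr2 X2]] := C2.
have cr12 u v : cr1 u v = l *: cr2 u v.
  by apply: (dot_inj (g := g1)) => w; rewrite gcr1 -gcr2 g2E dotZl.
have c0 : g1 (cr1 x y) (cr1 x y) != 0.
  have [z xyz] := compatible_nondegenerate gcr1 X1 xy.
  rewrite gt_eqF // dot_gt0 //; apply: contraNneq xyz => c0.
  by rewrite -gcr1 c0 linear0l.
have l3 : l ^+ 3 = 1.
  have n2 := cross_norm X2 x y; rewrite !g2E in n2.
  apply: (mulIf c0); rewrite mul1r [in RHS]cr12 dotZl dotZr n2 (cross_norm X1).
  by ring.
have l1 : l = 1.
  by apply/eqP; rewrite -(pexpr_eq1 (n := 3)) ?l3 // ltW.
by move=> u v; rewrite g2E l1 mul1r.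
Qed.

End Uniqueness.

Theorem theorem3p2 (R : realType) (V : vectType R) (dimV : \dim {:V} = 7%N)
    (phi phi' : form3 V) :
  [/\ (form3_nondegenerate phi <->
        exists g : {dot V for idfun}, compatible g phi),
      (forall g1 g2 : {dot V for idfun},
        compatible g1 phi -> compatible g2 phi ->
        forall u v : V, g1 u v = g2 u v)
    & (form3_nondegenerate phi -> form3_nondegenerate phi' ->
       forall g g' : {dot V for idfun},
         compatible g phi -> compatible g' phi' ->
       forall u v w u' v' w' : V,
         orthonormal g [:: u; v; w] -> phi u v w = 0 ->
         orthonormal g' [:: u'; v'; w'] -> phi' u' v' w' = 0 ->
       exists f : 'End(V),
         [/\ bijective f, f u = u', f v = v', f w = w'
           & forall x y z : V, phi' (f x) (f y) (f z) = phi x y z])].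
Proof.
split.
- split=> [nd|[g [cr [gcr X]]]]; last exact: compatible_nondegenerate gcr X.
  have [e0 [e1 [e2 [e3 [e4 [e5 [e6 C]]]]]]] := exists_cayley_frame dimV nd.
  exact: (cayley_compatible dimV C).
- by move=> g1 g2 C1 C2; apply: (compatible_unique dimV C1 C2).
move=> _ _ g g' [cr [gcr X]] [cr' [gcr' X']] u v w u' v' w'.
have frame_of (h : {dot V for idfun}) (psi : form3 V) c a b d :
    (forall x y z, h (c x y) z = psi x y z) -> cross_product h c ->
    orthonormal h [:: a; b; d] -> psi a b d = 0 ->
    cayley_frame psi a b (c a b) d (c a d) (c b d) (c (c a b) d).
  move=> hc Y; rewrite /orthonormal /= !andbT -!andbA.
  case/and5P=> /eqP aa /eqP bb /eqP dd /eqP ab /andP[/eqP ad /eqP bd].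
  exact: cayley_of_orthonormal.
move=> o_uvw uvw o_uvw' uvw'.
apply: (cayley_iso dimV (frame_of _ _ _ _ _ _ gcr X o_uvw uvw)
  (frame_of _ _ _ _ _ _ gcr' X' o_uvw' uvw')).
Qed.
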